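(* Let $G$ be a finite group, $S$ a non-empty inverse-closed subset of $G\setminus\{1\}$, $\mathbb{F}$ a finite field, and $B\le\mathbb{F}^S$ a linear code. Let $L=A(G,S,B)$ be the group of all $\sigma\in\mathrm{Aut}(G)$ such that $S^\sigma=S$ and the permutation of $S$ induced by $\sigma$ lies in $\mathrm{Aut}(B)$. Let $S=\bigcup_{i\in\mathbf{I}}S_i$ be the unique finest partition of $S$ such that each part $S_i$ is both inverse-closed and $L$-invariant. For each $i\in\mathbf{I}$ let $B_i=\{b|_{S_i}\mid b\in B\}\le\mathbb{F}^{S_i}$ be the restriction of $B$ to $S_i$. Then for each $i\in\mathbf{I}$, the Cayley graph $\mathrm{Cay}(G,S_i)$ is normal edge-transitive and the Cayley code $\mathbf{C}(G,S_i,B_i)$ is symmetric. Further, if $B=\bigoplus_{i\in\mathbf{I}}B_i$, then $\mathbf{C}(G,S,B)=\bigoplus_{i\in\mathbf{I}}\mathbf{C}(G,S_i,B_i)$.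
   Context: For a finite set $X$, $\mathbb{F}^X$ is the $\mathbb{F}$-vector space of functions $f:X\to\mathbb{F}$; a linear code is a subspace $C\le\mathbb{F}^X$. $\mathrm{Aut}(C)$ is the group of all $\rho\in\mathrm{Sym}(X)$ whose induced action on $\mathbb{F}^X$ leaves $C$ invariant; $C$ is symmetric if $\mathrm{Aut}(C)$ is transitive on $X$. If $X=\bigcup_k X_k$ is a disjoint union then $\mathbb{F}^X=\bigoplus_k\mathbb{F}^{X_k}$ (via restriction of functions), and direct sums of codes $C_k\le\mathbb{F}^{X_k}$ are taken inside $\mathbb{F}^X$ in this sense. For a finite group $G$ and a non-empty inverse-closed subset $S\subseteq G\setminus\{1\}$, the Cayley graph $\mathrm{Cay}(G,S)$ has vertex set $G$ and edge set $E=\{\{g,sg\}\mid g\in G,\ s\in S\}$. It admits as automorphisms the elements of $G\rtimes A(G,S)$, where $A(G,S)=\{\sigma\in\mathrm{Aut}(G)\mid S^\sigma=S\}$, with $x\in G$ acting on vertices by $g\mapsto gx$ and $\sigma\in A(G,S)$ acting by $g\mapsto g^\sigma$. $\mathrm{Cay}(G,S)$ is normal edge-transitive if $G\rtimes A(G,S)$ is transitive on its edge set. For a linear code $B\le\mathbb{F}^S$, the Cayley code is $$\mathbf{C}(G,S,B)=\{f\in\mathbb{F}^E\mid \text{for all } g\in G, \text{ the function } S\to\mathbb{F},\ s\mapsto f(\{g,sg\}), \text{ lies in } B\}.$$ The edge set of $\mathrm{Cay}(G,S)$ is the disjoint union of the edge sets of the graphs $\mathrm{Cay}(G,S_i)$.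 *)

(* Defs.v *)
From HB Require Import structures.
From mathcomp Require Import all_boot all_order all_algebra all_fingroup.

Set Implicit Arguments.
Unset Strict Implicit.
Unset Printing Implicit Defensive.

Import GroupScope GRing.Theory.

(* A subset X of a finite type, regarded as a finite type. *)
Notation elt X := {x | x \in X}.

(* F^X; the regular module F^o carries the vector space structure of F. *)
Notation fspace F X := {ffun elt X -> F^o}.

Notation code F X := {vspace fspace F X}.

Section Pullback.
Variables (F : finFieldType) (X Y : finType).

Definition pullback (h : Y -> X) (f : {ffun X -> F^o}) : {ffun Y -> F^o} :=
  [ffun y => f (h y)].

Fact pullback_is_linear h : linear (pullback h).
Proof. by move=> a f f'; apply/ffunP=> y; rewrite !ffunE. Qed.

HB.instance Definition _ h :=
  GRing.isLinear.Build F {ffun X -> F^o} {ffun Y -> F^o} _ (pullback h)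
    (pullback_is_linear h).

End Pullback.

Section Transfer.
Variables (F : finFieldType) (T : finType) (X Y : {set T}).

(* The restriction map F^X -> F^Y when Y is a subset of X, and extension by  *)
(* zero, i.e., the embedding of F^X as a direct summand of F^Y, when X is a  *)
(* subset of Y.                                                              *)
Definition transfer (f : fspace F X) : fspace F Y :=
  [ffun y => oapp f 0%R (insub (val y))].

Fact transfer_is_linear : linear transfer.
Proof.
move=> a f f'; apply/ffunP=> y; rewrite !ffunE.
by case: insub => [x|] /=; rewrite ?ffunE // scaler0 addr0.
Qed.

HB.instance Definition _ :=
  GRing.isLinear.Build F (fspace F X) (fspace F Y) _ transfer
    transfer_is_linear.

Definition transfer_code (C : code F X) : code F Y := (linfun transfer @: C)%VS.

End Transfer.

Section TransferFacts.
Variables (F : finFieldType) (T : finType) (X Y : {set T}).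

Lemma transfer_restrE (f : fspace F X) (y : elt Y) (Xy : val y \in X) :
  transfer Y f y = f (Sub (val y) Xy).
Proof. by rewrite ffunE insubT. Qed.

Lemma transfer_ext0E (f : fspace F X) (y : elt Y) :
  val y \notin X -> transfer Y f y = 0%R.
Proof. by move=> Xy; rewrite ffunE insubN. Qed.

End TransferFacts.

(* D is the direct sum, inside F^X, of the codes C i <= F^(Y i), i \in P. *)
Definition is_code_dsum (F : finFieldType) (T I : finType) (X : {set T})
    (P : {set I}) (Y : I -> {set T}) (D : code F X)
    (C : forall i, code F (Y i)) : Prop :=
  directv (\sum_(i in P) transfer_code X (C i)) /\
  D = (\sum_(i in P) transfer_code X (C i))%VS.

Section CodeAut.
Variables (F : finFieldType) (X : finType).

(* rho maps f to the function x |-> f (x^(rho^-1)). *)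
Definition code_act (rho : {perm X}) : 'End({ffun X -> F^o}) :=
  linfun (pullback (F := F) (rho^-1)).

Definition code_Aut (C : {vspace {ffun X -> F^o}}) : {set {perm X}} :=
  [set rho | (code_act rho @: C)%VS == C].

Lemma code_Aut_group_set C : group_set (code_Aut C).
Proof.
apply/group_setP; split=> [|rho tau].
  rewrite inE -[X in _ == X]lim1g; apply/eqP; congr (_ @: _)%VS.
  apply/lfunP=> f; rewrite id_lfunE lfunE /=.
  by apply/ffunP=> x; rewrite ffunE invg1 perm1.
rewrite !inE => /eqP rhoC /eqP tauC.
rewrite -[X in _ == X]tauC -[in X in _ == X]rhoC -limg_comp.
apply/eqP; congr (_ @: _)%VS; apply/lfunP=> f; rewrite comp_lfunE !lfunE /=.
by apply/ffunP=> x; rewrite !ffunE invMg permM.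
Qed.

Canonical code_Aut_group C := Group (code_Aut_group_set C).

Definition symmetric_code C : bool :=
  [transitive code_Aut C, on [set: X] | 'P].

End CodeAut.

(* The finite group G is the group of all elements of gT. *)
Section Cayley.
Variables (gT : finGroupType).

Definition cay_edges (S : {set gT}) : {set {set gT}} :=
  [set [set g; s * g] | g in [set: gT], s in S].

Definition cay_Aut (S : {set gT}) : {set {perm gT}} :=
  'N_(Aut [set: gT])(S | 'P).

Definition right_trans (x : gT) : {perm gT} := perm (mulIg x).

(* The image in Sym(G) of the semidirect product of G and A(G,S), consisting *)
(* of the permutations g |-> (g x)^sigma.                                    *)
Definition cay_hol (S : {set gT}) : {set {perm gT}} :=
  [set right_trans x | x : gT] * cay_Aut S.

Definition normal_edge_transitive (S : {set gT}) : bool :=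
  [transitive cay_hol S, on cay_edges S | 'P^*].

Fact cay_edge_subproof (S : {set gT}) (g : gT) (s : elt S) :
  [set g; val s * g] \in cay_edges S.
Proof. by apply: imset2_f; rewrite ?inE ?(valP s). Qed.

Definition cay_edge (S : {set gT}) (g : gT) (s : elt S) : elt (cay_edges S) :=
  Sub [set g; val s * g] (cay_edge_subproof g s).

Definition cayley_code (F : finFieldType) (S : {set gT}) (B : code F S) :
    code F (cay_edges S) :=
  (\bigcap_(g : gT) (linfun (pullback (F := F) (@cay_edge S g)) @^-1: B))%VS.

Lemma mem_cayley_code (F : finFieldType) (S : {set gT}) (B : code F S)
    (f : fspace F (cay_edges S)) :
  f \in cayley_code B <->
  forall g, [ffun s => f (cay_edge g s)] \in B.
Proof.
rewrite memvE; split=> [/subv_bigcapP fB g | fB].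
  by have := fB g isT; rewrite -memvE -memv_preim lfunE.
by apply/subv_bigcapP=> g _; rewrite -memvE -memv_preim lfunE /=; apply: fB.
Qed.

(* A(G,S,B); actperm 'P^? sigma is the permutation of S induced by sigma. *)
Definition cay_code_Aut (F : finFieldType) (S : {set gT}) (B : code F S) :
    {set {perm gT}} :=
  [set sigma in cay_Aut S
     | actperm (subaction (elt S) 'P) sigma \in code_Aut B].

Lemma cay_code_Aut_inducedE (S : {set gT}) sigma (s : elt S) :
  sigma \in cay_Aut S ->
  val (actperm (subaction (elt S) 'P) sigma s) = sigma (val s).
Proof.
case/setIP=> _ nS; rewrite actpermE val_subact.
suff -> : sigma \in subact_dom (fun x => x \in S) 'P by [].
by rewrite /subact_dom (_ : [set x | x \in S] = S) //; apply/setP=> x; rewrite inE.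
Qed.

Definition inv_stable (L : {set {perm gT}}) (A : {set gT}) : bool :=
  (A^-1 == A) && [acts L, on A | 'P].

End Cayley.

Definition refines (T : finType) (P Q : {set {set T}}) : bool :=
  [forall A in P, exists A' in Q, A \subset A'].

(* P is the finest partition of D all of whose parts satisfy good. *)
Definition finest_partition (T : finType) (good : pred {set T}) (D : {set T})
    (P : {set {set T}}) : Prop :=
  [/\ partition P D, {in P, forall A, good A} &
      forall Q, partition Q D -> {in Q, forall A, good A} -> refines P Q].

Lemma finest_partition_unique (T : finType) (good : pred {set T}) D P Q :
  finest_partition good D P -> finest_partition good D Q -> P = Q.
Proof.
suff sub P1 P2 : finest_partition good D P1 -> finest_partition good D P2 ->
    P1 \subset P2.
  by move=> fP fQ; apply/eqP; rewrite eqEsubset !sub.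
move=> [pP gP fP] [pQ gQ fQ]; apply/subsetP=> A PA.
have /forall_inP/(_ A PA)/exists_inP[A' QA' sAA'] := fP _ pQ gQ.
have /forall_inP/(_ A' QA')/exists_inP[A2 PA2 sA'A2] := fQ _ pP gP.
have tP := partition_trivIset pP.
have /set0Pn[x Ax] := partition_neq0 pP PA.
have A2x : x \in A2 by apply/(subsetP sA'A2)/(subsetP sAA').
have eA : A = A2 by rewrite -(def_pblock tP PA Ax) (def_pblock tP PA2 A2x).
suff -> : A = A' by [].
by apply/eqP; rewrite eqEsubset sAA' eA.
Qed.

Lemma finest_inv_stable_partition_exists (gT : finGroupType) L (S : {set gT}) :
  inv_stable L S -> exists P, finest_partition (inv_stable L) S P.
Proof.
have inv_stableV A x : inv_stable L A -> (x^-1 \in A) = (x \in A).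
  by case/andP=> /eqP eA _; rewrite -{1}eA mem_invg invgK.
have inv_stableP A s x : inv_stable L A -> s \in L -> (s x \in A) = (x \in A).
  by case/andP=> _ /subsetP nA Ls; apply: (astabs_act x (nA s Ls)).
move=> gS; pose f (x : gT) := [set A : {set gT} | inv_stable L A & x \in A].
have fV x : f x^-1 = f x.
  by apply/setP=> A; rewrite !inE; case gA: (inv_stable L A); rewrite /= ?inv_stableV.
have fL s x : s \in L -> f (s x) = f x.
  move=> Ls; apply/setP=> A; rewrite !inE.
  by case gA: (inv_stable L A); rewrite /= ?(inv_stableP _ s).
exists (preim_partition f S); split; first exact: preim_partitionP.
  move=> _ /imsetP[x Sx ->]; apply/andP; split.
    by apply/eqP/setP=> y; rewrite mem_invg !inE fV inv_stableV.
  apply/subsetP=> s Ls; rewrite !inE; apply/subsetP=> y.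
  by rewrite !inE /aperm fL ?inv_stableP.
move=> Q pQ gQ; apply/forall_inP=> _ /imsetP[x Sx ->]; apply/exists_inP.
have Qx : x \in cover Q by rewrite (cover_partition pQ).
exists (pblock Q x); first exact: pblock_mem.
apply/subsetP=> y; rewrite inE => /andP[_ /eqP/setP/(_ (pblock Q x))].
by rewrite !inE gQ ?pblock_mem //= mem_pblock Qx => <-.
Qed.

Lemma finest_cay_partition_exists (F : finFieldType) (gT : finGroupType)
    (S : {set gT}) (B : code F S) :
  S^-1 = S ->
  exists! P, finest_partition (inv_stable (cay_code_Aut B)) S P.
Proof.
move=> SV; have gS : inv_stable (cay_code_Aut B) S.
  rewrite /inv_stable SV eqxx; apply/subsetP=> s.
  by rewrite inE => /andP[/setIP[]].
have [P fP] := finest_inv_stable_partition_exists gS.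
by exists P; split=> // Q; apply: finest_partition_unique.
Qed.

(* Main.v *)
(* A part A of the finest partition is x^L :|: (x^-1)^L for any x in A, since  *)
(* these sets form an inverse-closed, L-invariant partition of S. So for s and *)
(* t in A some sigma in L maps s to t or t^-1, and composing sigma with a      *)
(* right translation maps the edge {1, s} to any prescribed edge {g, t g}.     *)
(* These affine maps permute the local views of an edge function and act on    *)
(* each of them by sigma in Aut(B), hence preserve the Cayley code of A.       *)
(* For the direct sum, the edges of the Cay(G, A) are disjoint, and restriction*)
(* and extension by zero commute with taking local views.                      *)

Require Import Defs.
From mathcomp Require Import all_boot all_order all_algebra all_fingroup.

Set Implicit Arguments.
Unset Strict Implicit.
Unset Printing Implicit Defensive.

Import GroupScope GRing.Theory.

(** Both claims about a part [A] rest on one fact: any two elements of [A] are related by [L] up to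
    inversion ([finest_inv_stable_part]). Edges do not see this ambiguity, since {g, t g} is also
    the edge with label t^-1 at t g. So the maps g -> (g x)^sigma with sigma in [L] are transitive
    on the edges of Cay(G, A) ([affine_edge_transitive]), and the permutations of edges that they
    induce are automorphisms of the code ([edge_perm_code_Aut]). The direct sum holds because an
    edge determines its label up to inversion ([mem_cay_edges]): distinct parts have disjoint edge
    sets, and splitting an edge function over them splits each of its local views ([sum_transfer],
    [local_transfer]). *)

Lemma code_AutP (F : finFieldType) (X : finType)
    (C : {vspace {ffun X -> F^o}}) (rho : {perm X}) :
  reflect (forall f : {ffun X -> F^o}, f \in C -> [ffun x => f (rho x)] \in C)
          (rho \in code_Aut C).
Proof.
apply: (iffP idP) => [|stabC].
  (* Composing with [rho] is the action of [rho^-1], hence the passage to the inverse. *)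
  rewrite -groupV inE => /eqP defC f Cf; rewrite -defC.
  have -> : [ffun x => f (rho x)] = code_act F rho^-1 f.
    by rewrite lfunE; apply/ffunP=> x; rewrite !ffunE invgK.
  exact: memv_img.
rewrite -groupV inE eqEdim; apply/andP; split.
  apply/subvP=> _ /memv_imgP[f Cf ->]; rewrite lfunE /=.
  have -> : pullback (rho^-1)^-1 f = [ffun x => f (rho x)].
    by apply/ffunP=> x; rewrite !ffunE invgK.
  exact: stabC.
(* The inclusion is an equality because the action has trivial kernel, so the dimensions agree. *)
rewrite limg_dim_eq //; apply/eqP; rewrite -subv0; apply/subvP=> f.
rewrite memv_cap memv_ker lfunE /= => /andP[_ /eqP/ffunP f0].
rewrite memv0; apply/eqP/ffunP=> x.
by have := f0 (rho^-1 x); rewrite !ffunE invgK permKV.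
Qed.

Lemma transfer_codeP (F : finFieldType) (T : finType) (X Y : {set T})
    (C : code F X) (f : fspace F Y) :
  reflect (exists2 c, c \in C & f = transfer Y c) (f \in transfer_code Y C).
Proof.
by apply: (iffP memv_imgP) => [] [c Cc ->]; exists c; rewrite ?lfunE.
Qed.

Lemma mem_transfer_code (F : finFieldType) (T : finType) (X Y : {set T})
    (C : code F X) (c : fspace F X) :
  c \in C -> transfer Y c \in transfer_code Y C.
Proof. by move=> Cc; apply/transfer_codeP; exists c. Qed.

Section DisjointSum.
Variables (F : finFieldType) (T I : finType) (X : {set T}) (P : {set I}).
Variable Y : I -> {set T}.
Hypothesis disjY : forall x i j,
  i \in P -> j \in P -> x \in Y i -> x \in Y j -> i = j.

(** Summands have disjoint supports: at a point of [Y i] a vanishing sum reduces to its term of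
    index [i]. *)
Lemma directv_transfer_code (C : forall i, code F (Y i)) :
  directv (\sum_(i in P) transfer_code X (C i)).
Proof.
apply/directv_sum_independent=> u Cu u0 i Pi; apply/ffunP=> x.
have supp j : j \in P -> val x \notin Y j -> u j x = 0%R.
  move=> Pj Yj'x; have /transfer_codeP[c _ ->] := Cu j Pj.
  exact: transfer_ext0E.
have [Yix | /supp->] := boolP (val x \in Y i); rewrite ?ffunE //.
move/ffunP/(_ x): u0; rewrite sum_ffunE ffunE (bigD1 i) //= big1 ?addr0 //.
move=> j /andP[Pj neq_ji]; apply: supp => //.
by apply: contraNN neq_ji => Yjx; rewrite (disjY Pj Pi Yjx Yix).
Qed.

Lemma sum_transfer (f : fspace F X) :
  (forall x, x \in X -> exists2 i, i \in P & x \in Y i) ->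
  f = (\sum_(i in P) transfer X (transfer (Y i) f))%R.
Proof.
move=> covY; apply/ffunP=> x; have [i Pi Yix] := covY _ (valP x).
rewrite sum_ffunE (bigD1 i) //= big1 => [|j /andP[Pj neq_ji]].
  rewrite addr0 transfer_restrE transfer_restrE ?(valP x) // => Xx.
  by congr (f _); apply: val_inj.
apply: transfer_ext0E.
by apply: contraNN neq_ji => Yjx; rewrite (disjY Pj Pi Yjx Yix).
Qed.

End DisjointSum.

Section CayleyCode.
Variables (F : finFieldType) (gT : finGroupType).
Implicit Types (S A : {set gT}) (sigma : {perm gT}).

Lemma cay_AutP S sigma :
  reflect (sigma \in Aut [set: gT] /\ forall s, s \in S -> sigma s \in S)
          (sigma \in cay_Aut S).
Proof.
apply: (iffP setIP) => [] [Asigma nS]; split=> //.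
  by move=> s Ss; rewrite -[sigma s]/('P%act s sigma) astabs_act.
by rewrite !inE /=; apply/subsetP=> s Ss; rewrite inE; apply: nS.
Qed.

Lemma Aut_setT_M sigma :
  sigma \in Aut [set: gT] -> {morph sigma : x y / x * y}.
Proof. by rewrite inE => /andP[_ /morphicP M] x y; apply: M; rewrite inE. Qed.

Lemma Aut_setT_V sigma :
  sigma \in Aut [set: gT] -> {morph sigma : x / x^-1}.
Proof.
move=> /Aut_setT_M M x; apply: (mulgI (sigma x)).
by rewrite -M !mulgV; apply: (mulgI (sigma 1)); rewrite -M !mulg1.
Qed.

(** Any [rho] lying over [sigma] may serve as the induced permutation, which hides [subaction] and
    its domain condition. *)
Lemma cay_code_AutP S (B : code F S) sigma :
  reflect (sigma \in cay_Aut S /\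
           exists2 rho, rho \in code_Aut B
                      & forall s, val (rho s) = sigma (val s))
          (sigma \in cay_code_Aut B).
Proof.
rewrite [_ \in cay_code_Aut _]in_set; apply: (iffP andP) => [] [Ssigma].
  move=> Brho; split=> //; exists (actperm (subaction (elt S) 'P) sigma) => //.
  by move=> s; apply: cay_code_Aut_inducedE.
case=> rho Brho rhoE; split=> //.
suff -> : actperm (subaction (elt S) 'P) sigma = rho by [].
by apply/permP=> s; apply: val_inj; rewrite rhoE cay_code_Aut_inducedE.
Qed.

Lemma cay_code_Aut_group_set S (B : code F S) : group_set (cay_code_Aut B).
Proof.
apply/group_setP; split=> [|sigma tau].
  apply/cay_code_AutP; split; first exact: group1.
  by exists 1; rewrite ?group1 // => s; rewrite !perm1.
move=> /cay_code_AutP[Ssigma [rho Brho rhoE]].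
move=> /cay_code_AutP[Stau [rho' Brho' rhoE']].
apply/cay_code_AutP; split; first exact: groupM.
by exists (rho * rho'); rewrite ?groupM // => s; rewrite !permM rhoE' rhoE.
Qed.

Lemma finest_inv_stable_part (L : {group {perm gT}}) S P A s t :
    L \subset Aut [set: gT] -> inv_stable L S ->
    finest_partition (inv_stable L) S P ->
    A \in P -> s \in A -> t \in A ->
  exists2 sigma, sigma \in L & t = sigma s \/ t = sigma s^-1.
Proof.
move=> /subsetP AutL /andP[/eqP SV /subsetP nS] [partP _ fineP] PA As At.
pose O x := orbit 'P L x :|: orbit 'P L x^-1.
have OV x : O x^-1 = O x by rewrite /O invgK setUC.
have OL x sigma : sigma \in L -> O (sigma x) = O x.
  move=> Lsigma; rewrite /O -(Aut_setT_V (AutL _ Lsigma)).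
  by rewrite !(orbit_act 'P).
(* The comparison partition consists of the fibres of [O] on [S]. They are disjoint by construction,
   and stable because [O] is constant under inversion and [L]. *)
have goodQ : {in preim_partition O S, forall A', inv_stable L A'}.
  move=> _ /imsetP[x Sx ->]; apply/andP; split.
    by apply/eqP/setP=> y; rewrite mem_invg !inE OV -mem_invg SV.
  apply/subsetP=> sigma Lsigma; rewrite !inE; apply/subsetP=> y.
  rewrite !inE => /andP[Sy /eqP->]; rewrite OL // eqxx andbT.
  by rewrite (astabs_act y (nS _ Lsigma)).
have /forall_inP/(_ A PA)/exists_inP[_ /imsetP[x Sx ->] /subsetP sAO] :=
  fineP _ (preim_partitionP O S) goodQ.
have eO u : u \in A -> O x = O u by move/sAO; rewrite inE => /andP[_ /eqP].
have : t \in O s by rewrite -(eO s) // (eO t) // inE orbit_refl.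
by rewrite inE => /orP[] /imsetP[sigma Lsigma ->]; exists sigma; auto.
Qed.

Definition affine (x : gT) sigma : {perm gT} := Defs.right_trans x * sigma.

Lemma affineE x sigma g : affine x sigma g = sigma (g * x).
Proof. by rewrite permM permE. Qed.

Lemma affine_cay_edge x sigma g s :
    sigma \in Aut [set: gT] ->
  affine x sigma @: [set g; s * g] =
    [set sigma (g * x); sigma s * sigma (g * x)].
Proof.
move=> Asigma; rewrite imsetU1 imset_set1 !affineE -mulgA.
by rewrite (Aut_setT_M Asigma s).
Qed.

Lemma affine_cay_edges x sigma A (e : {set gT}) :
    sigma \in cay_Aut A -> e \in cay_edges A ->
  affine x sigma @: e \in cay_edges A.
Proof.
move=> /cay_AutP[Asigma nA] /imset2P[g s _ As ->].
by rewrite affine_cay_edge //; apply: imset2_f; rewrite ?inE ?nA.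
Qed.

Definition edge_map x sigma A (sA : sigma \in cay_Aut A) (e : elt (cay_edges A)) :
    elt (cay_edges A) :=
  Sub (affine x sigma @: val e) (affine_cay_edges x sA (valP e)).

Lemma edge_map_inj x sigma A (sA : sigma \in cay_Aut A) :
  injective (edge_map x sA).
Proof. by move=> e e' /(congr1 val) /(imset_inj perm_inj) /val_inj. Qed.

Definition edge_perm x sigma A (sA : sigma \in cay_Aut A) :=
  perm (@edge_map_inj x sigma A sA).

Lemma local_transfer A S (f : fspace F (cay_edges S)) (g : gT) :
    A \subset S ->
  [ffun s => transfer (cay_edges A) f (cay_edge g s)] =
    transfer A [ffun s => f (cay_edge g s)].
Proof.
move=> /subsetP sAS; apply/ffunP=> s.
rewrite ffunE transfer_restrE => [|e].
  by apply: imset2_f; rewrite ?inE ?sAS ?(valP s).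
rewrite transfer_restrE ?sAS ?(valP s) // => Ss; rewrite ffunE.
by congr (f _); apply: val_inj.
Qed.

(** The view at g of the permuted function is the view of [f] at sigma(g x), with labels moved by
    [sigma]. If the latter is the restriction of b in [B], the former is the restriction of b
    composed with [rho], again in [B]. *)
Lemma edge_perm_code_Aut S A (B : code F S) x sigma (sA : sigma \in cay_Aut A) :
    A \subset S -> sigma \in cay_code_Aut B ->
  edge_perm x sA \in code_Aut (cayley_code (transfer_code A B)).
Proof.
move=> /subsetP sAS /cay_code_AutP[_ [rho /code_AutP Brho rhoE]].
have [Asigma nA] := cay_AutP _ _ sA.
apply/code_AutP=> f /mem_cayley_code Cf; apply/mem_cayley_code=> g.
have /transfer_codeP[b Bb /ffunP fb] := Cf (sigma (g * x)).
apply/transfer_codeP; exists [ffun s => b (rho s)]; first exact: Brho.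
apply/ffunP=> s; have As := valP s; have := fb (Sub (sigma (val s)) (nA _ As)).
rewrite !ffunE permE !insubT ?sAS ?nA // => [Ss Ss'] /=; rewrite ffunE => e.
transitivity (b (Sub (sigma (val s)) Ss')); last first.
  by congr (b _); apply: val_inj; rewrite rhoE.
by rewrite -e; congr (f _); apply: val_inj; rewrite /= affine_cay_edge.
Qed.

(* If t = sigma(s^-1), the edge {1, s} is mapped to {g, t g} with its ends
   exchanged, so the translation has to send 1 to t g. *)
Lemma affine_edge_transitive s t sigma g :
    sigma \in Aut [set: gT] -> t = sigma s \/ t = sigma s^-1 ->
  exists x, affine x sigma @: [set 1; s * 1] = [set g; t * g].
Proof.
move=> Asigma [-> | ->].
  by exists (sigma^-1 g); rewrite affine_cay_edge // mul1g permKV.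
exists (sigma^-1 (sigma s^-1 * g)); rewrite affine_cay_edge // mul1g permKV.
by rewrite Aut_setT_V // mulKVg setUC.
Qed.

(** As [s != 1], the edge has two distinct ends, so {g, s g} = {h, t h} forces s = t or s^-1 = t
    according to which end is h. *)
Lemma mem_cay_edges A g s :
  A^-1 = A -> s != 1 -> ([set g; s * g] \in cay_edges A) = (s \in A).
Proof.
move=> AV ns; apply/idP/idP=> [/imset2P[h t _ At eq_e] | As]; last first.
  by apply: imset2_f; rewrite ?inE.
have nsg : s * g != g.
  by apply: contraNneq ns => /(canRL (mulgK _))->; rewrite mulgV.
have : s * g \in [set h; t * h] by rewrite -eq_e !inE eqxx orbT.
have : g \in [set h; t * h] by rewrite -eq_e !inE eqxx.
rewrite !inE => /orP[]/eqP eg /orP[]/eqP es; first by rewrite es eg eqxx in nsg.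
- by have -> : s = t by apply: (mulIg h); rewrite -es eg.
- rewrite -AV mem_invg; suff -> : s^-1 = t by [].
  by apply: (mulIg h); rewrite -eg -es mulKg.
by rewrite es -eg eqxx in nsg.
Qed.

End CayleyCode.

Theorem theorem1p3 (F : finFieldType) (gT : finGroupType) (S : {set gT})
    (B : code F S) (P : {set {set gT}}) :
  S != set0 -> (S^-1)%g = S -> 1%g \notin S ->
  finest_partition (inv_stable (cay_code_Aut B)) S P ->
  (forall A, A \in P ->
     normal_edge_transitive A /\
     symmetric_code (cayley_code (transfer_code A B))) /\
  (is_code_dsum P B (fun A => transfer_code A B) ->
   is_code_dsum P (cayley_code B)
     (fun A => cayley_code (transfer_code A B))).
Proof.
move=> _ SV S'1 finestP; have [partP goodP _] := finestP.
pose L := Group (cay_code_Aut_group_set B).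
have sAS A : A \in P -> A \subset S.
  by move=> PA; rewrite -(cover_partition partP) /cover (bigcup_sup A).
have LSAut sigma : sigma \in L -> sigma \in cay_Aut S by case/cay_code_AutP.
have AutL : L \subset Aut [set: gT] by apply/subsetP=> sigma /LSAut/cay_AutP[].
have goodS : inv_stable L S.
  by rewrite /inv_stable SV eqxx; apply/subsetP=> sigma /LSAut/setIP[].
split=> [A PA | [_ defB]].
  have [s As] := set0Pn _ (partition_neq0 partP PA).
  have LAAut sigma : sigma \in L -> sigma \in cay_Aut A.
    move=> Lsigma; apply/setIP; split; first exact: (subsetP AutL).
    by have /andP[_ /subsetP] := goodP A PA; apply.
  (* The edge {1, s} serves as base point for both transitivity claims. *)
  have reach e : e \in cay_edges A -> exists x sigma,
      sigma \in L /\ affine x sigma @: [set 1; s * 1] = e.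
    case/imset2P=> g t _ At ->.
    have [sigma Lsigma t_s] := finest_inv_stable_part AutL goodS finestP PA As At.
    have [x ex] := affine_edge_transitive g (subsetP AutL _ Lsigma) t_s.
    by exists x, sigma.
  have E1 : [set 1; s * 1] \in cay_edges A by apply: imset2_f; rewrite ?inE.
  (* Transitivity unfolds to: the whole set is the orbit of one of its points. *)
  split; apply/imsetP.
    exists [set 1; s * 1] => //; apply/setP=> e; apply/idP/imsetP.
      case/reach=> x [sigma [/LAAut Asigma <-]]; exists (affine x sigma) => //.
      by rewrite mem_mulg ?imset_f.
    case=> _ /mulsgP[_ sigma /imsetP[x _ ->] Asigma ->] ->.
    exact: (affine_cay_edges x Asigma E1).
  exists (Sub [set 1; s * 1] E1); rewrite ?inE //.
  apply/setP=> e; rewrite inE; apply/esym/imsetP.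
  have [x [sigma [Lsigma ex]]] := reach _ (valP e).
  exists (edge_perm x (LAAut _ Lsigma)).
    exact: edge_perm_code_Aut (sAS A PA) _.
  by apply: val_inj; rewrite /= /aperm permE.
have n1S s : s \in S -> s != 1 by apply: contraTneq => ->.
have disjP e A A' :
    A \in P -> A' \in P -> e \in cay_edges A -> e \in cay_edges A' -> A = A'.
  move=> PA PA' Ae A'e; have /andP[/eqP A'V _] := goodP A' PA'.
  case/imset2P: Ae A'e => g s _ As ->.
  rewrite mem_cay_edges ?n1S ?(subsetP (sAS A PA)) // => A's.
  have tP := partition_trivIset partP.
  by rewrite -(def_pblock tP PA As) (def_pblock tP PA' A's).
split; first exact: directv_transfer_code disjP _.
apply/eqP; rewrite eqEsubv; apply/andP; split.
  apply/subvP=> f /mem_cayley_code Cf.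
  (* [f] is the sum of its restrictions to the edge sets of the parts, extended by zero. *)
  rewrite [f](sum_transfer disjP) => [|_ /imset2P[g s _ Ss ->]].
    apply: memv_sumr => A PA; apply/mem_transfer_code/mem_cayley_code=> g.
    by rewrite local_transfer ?sAS //; apply: mem_transfer_code.
  have [A PA As] : exists2 A, A \in P & s \in A.
    by apply/bigcupP; rewrite -/(cover P) (cover_partition partP).
  by exists A => //; apply: imset2_f; rewrite ?inE.
apply/subv_sumP=> A PA; apply/subvP=> _ /transfer_codeP[f /mem_cayley_code Cf ->].
have /andP[/eqP AV _] := goodP A PA.
apply/mem_cayley_code=> g.
(* Extension by zero commutes with local views: for a label outside [A] the edge is not in Cay(G,
   A), so both sides vanish. *)
have -> : [ffun s => transfer (cay_edges S) f (cay_edge g s)] =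
          transfer S [ffun s => f (cay_edge g s)].
  apply/ffunP=> s; rewrite ffunE.
  have [As | A's] := boolP (val s \in A).
    rewrite !transfer_restrE => [|As']; first by apply: imset2_f; rewrite ?inE.
    by rewrite ffunE; congr (f _); apply: val_inj.
  by rewrite !transfer_ext0E //= mem_cay_edges ?n1S ?(valP s).
(* Only here is the decomposition of [B] needed: a view extended by zero lies in one summand of
   [B]. *)
rewrite defB; apply: (subvP (sumv_sup A PA (subvv _))).
exact: mem_transfer_code (Cf g).
Qed.
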